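(* Let $I$ be a finite nonempty set, $r\ge1$ and $d\ge0$ integers, and fix $i_0\in I$ (used for the torus embeddings). For every $i\in I$ the diagram $$\begin{array}{ccc}M^{\mathrm{lab}}_{0,I}(r,d)&\xrightarrow{\ \operatorname{ev}_i\ }&\mathbb T^r\\ {\scriptstyle\operatorname{trop}}\downarrow&&\downarrow{\scriptstyle\operatorname{trop}}\\ \mathfrak M^{\mathrm{lab}}_{0,I}(r,d)&\xrightarrow{\ \mathfrak{ev}_i\ }&\mathfrak T^r\end{array}$$ is commutative.
   Context: Ground field: $(K,\nu)$ is an algebraically closed valued field of characteristic $0$ (valuation possibly trivial). For a set $S$, $D(S)$ is the set of ordered pairs of distinct elements of $S$. $\mathbb T^r\subset\mathbb P^r$ is the torus of points with all coordinates nonzero; $\mathfrak T^r=\mathbb R^{r+1}/\mathbb R(1,\dots,1)$ with lattice $N$ the image of $\mathbb Z^{r+1}$; $s_i$ is the image of the $i$-th standard basis vector. For an algebraic torus with character lattice $M'$, $\operatorname{trop}$ sends a $K$-point $x$ to $(m\mapsto\nu(m(x)))\in\operatorname{Hom}(M',\mathbb R)$. Let $J=\{0,\dots,r\}\times\{1,\dots,d\}$ and $L_0=I\cup J$ (disjoint union); it is assumed that $|L_0|\ge3$. Algebraic curves: $M^{\mathrm{lab}}_{0,I}(r,d)$ is the set of isomorphism classes of labeled parametrized $I$-marked rational curves of degree $d$ in $\mathbb P^r$, i.e. of $(C,(p_\lambda)_{\lambda\in L_0},f)$ with $C\cong\mathbb P^1$, distinct points $p_\lambda\in C$, and $f:C\to\mathbb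 P^r$ a morphism of degree $d$ ($f_*[C]=d$) such that $f^{-1}(\{x_i=0\})=\{p_{ij}\mid1\le j\le d\}$ for each $i=0,\dots,r$. $\operatorname{ev}_i$ ($i\in I$) sends the curve to $f(p_i)\in\mathbb T^r$. The space is embedded in $\mathbb G_m^{D(L_0)}/\mathbb G_m^{L_0}\times\mathbb T^r$ by writing $C=\mathbb P^1$, $p_\lambda=(b_\lambda:a_\lambda)$ and sending the curve to $([(b_\lambda a_\mu-a_\lambda b_\mu)_{(\lambda,\mu)}],f(p_{i_0}))$, where $(x_\lambda)\in\mathbb G_m^{L_0}$ acts through $(x_\lambda x_\mu)_{(\lambda,\mu)}$. Tropical curves: an abstract rational tropical curve is a finite metric tree $\mathfrak C=(V,E,\ell)$, $\ell:E\to\mathbb R_{>0}\cup\{\infty\}$, without $2$-valent vertices and not consisting of exactly two vertices, such that the edges of infinite length are exactly those incident to a $1$-valent vertex (''legs''; the $1$-valent vertices are ''feet'', other vertices ''inner''); $\mathfrak C^\circ$ is $\mathfrak C$ without the feet. $\mathfrak M^{\mathrm{lab}}_{0,I}(r,d)$ is the set of isomorphism classes of $(\mathfrak C,(e_\lambda)_{\lambda\in L_0},\mathfrak f)$, where $\lambda\mapsto e_\lambda$ is a bijection from $L_0$ to the legs and $\mathfrak f:\mathfrak C^\circ\to\mathfrak T^r$ is continuous and affine linear on edges, with all direction vectors (derivative of $\mathfrak f|_e$ away from the inner vertex $v\in e$, with respect to length) in $N$, balanced (the direction vectors at every inner vertex sum to $0$), with direction $s_i$ on $e_{(i,j)}$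 for $(i,j)\in J$ and direction $0$ on $e_i$ for $i\in I$. $\mathfrak{ev}_i$ ($i\in I$) sends the curve to the point $\mathfrak f(e_i)$. With $\operatorname{dist}_{\mathfrak C}(\lambda,\mu)$ the distance between the inner vertices incident to $e_\lambda,e_\mu$ and $\Phi:\mathbb R^{L_0}\to\mathbb R^{D(L_0)}$, $(x_\lambda)\mapsto(x_\lambda+x_\mu)_{(\lambda,\mu)}$, the injective map $\mathfrak C\mapsto([(-\operatorname{dist}_{\mathfrak C}(\lambda,\mu)/2)_{(\lambda,\mu)}],\mathfrak{ev}_{i_0}(\mathfrak C))$ identifies $\mathfrak M^{\mathrm{lab}}_{0,I}(r,d)$ with a subset of $\mathbb R^{D(L_0)}/\operatorname{Im}\Phi\times\mathfrak T^r$, the tropicalization of $\mathbb G_m^{D(L_0)}/\mathbb G_m^{L_0}\times\mathbb T^r$. The left vertical map is the restriction of $\operatorname{trop}$ of the latter torus (it takes values in $\mathfrak M^{\mathrm{lab}}_{0,I}(r,d)$). *)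

(* Defs.v *)
From HB Require Import structures.
From mathcomp Require Import all_boot all_order all_algebra.
From mathcomp Require Import boolp classical_sets reals constructive_ereal.

Set Implicit Arguments.
Unset Strict Implicit.
Unset Printing Implicit Defensive.

Import Order.TTheory GRing.Theory Num.Theory.

Local Open Scope classical_set_scope.
Local Open Scope ring_scope.

Record is_valuation (K : fieldType) (R : realType) (nu : K -> \bar R) : Prop :=
  IsValuation {
    val0 : nu 0 = +oo%E;
    val_fin : forall x : K, x != 0 -> nu x \is a fin_num;
    valM : forall x y, nu (x * y) = (nu x + nu y)%E;
    valD : forall x y, (Order.min (nu x) (nu y) <= nu (x + y)%R)%E
  }.

(* Quotients G_m^X / G_m^Y, where G_m^Y acts on G_m^X through a homomorphism
   [act : G_m^Y -> G_m^X].  A K-point is given by a representative X -> K. *)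
Section QuotientTorus.
Variables (K : fieldType) (R : realType) (X Y : finType).

(* The character lattice M' of the quotient: the characters
   x |-> \prod_k x_k ^ m_k of G_m^X that are trivial on the image of G_m^Y. *)
Definition characters (act : (Y -> K) -> X -> K) : set (X -> int) :=
  [set m | forall t : Y -> K, (forall y, t y != 0) ->
           \prod_(k : X) act t k ^ m k = 1].

(* The class of w in R^X / Im lin, as a subset of R^X; two points of the
   quotient are equal iff these subsets are. *)
Definition real_class (lin : (Y -> R) -> X -> R) (w : X -> R) : set (X -> R) :=
  [set w' | exists t : Y -> R, forall k, w' k = w k + lin t k].

(* trop x is the functional m |-> nu (m x) on M'.  A functional on M' is
   identified with the class of all w in R^X that induce it by
   m |-> \sum_k m_k w_k; when lin is the real version of act, this is the usual
   identification of Hom(M', R) with R^X / Im lin. *)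
Definition trop (nu : K -> \bar R) (act : (Y -> K) -> X -> K) (x : X -> K) :
    set (X -> R) :=
  [set w | forall m, characters act m ->
           \sum_(k : X) w k *~ m k = fine (nu (\prod_(k : X) x k ^ m k))].

End QuotientTorus.

(* The torus T^r = G_m^(r+1) / G_m of P^r and the space R^(r+1) / R(1,...,1). *)
Definition diag_act (K : Type) (r : nat) (t : unit -> K) : 'I_r.+1 -> K :=
  fun=> t tt.

Definition tropT (K : fieldType) (R : realType) (nu : K -> \bar R) (r : nat)
    (x : 'I_r.+1 -> K) : set ('I_r.+1 -> R) :=
  trop nu (@diag_act K r) x.

Definition classT (R : realType) (r : nat) (w : 'I_r.+1 -> R) :
    set ('I_r.+1 -> R) :=
  real_class (@diag_act R r) w.

(* The point of N (the image of Z^(r+1)) represented by an integer vector. *)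
Definition classN (R : realType) (r : nat) (n : 'I_r.+1 -> int) :
    set ('I_r.+1 -> R) :=
  classT (fun k => (n k)%:~R).
Arguments classN R {r} n.

Definition std_vec (r : nat) (i : 'I_r.+1) : 'I_r.+1 -> int :=
  fun k => (k == i)%:R.

(* D(S), and the torus G_m^D(S) / G_m^S with the space R^D(S) / Im Phi. *)
Definition Dpairs (S : finType) : finType := {q : S * S | q.1 != q.2}.

Definition pair_act (K : fieldType) (S : finType) (t : S -> K) : Dpairs S -> K :=
  fun q => t (val q).1 * t (val q).2.

Definition Phi (R : realType) (S : finType) (t : S -> R) : Dpairs S -> R :=
  fun q => t (val q).1 + t (val q).2.

Definition tropD (K : fieldType) (R : realType) (nu : K -> \bar R) (S : finType)
    (x : Dpairs S -> K) : set (Dpairs S -> R) :=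
  trop nu (@pair_act K S) x.

Definition classD (R : realType) (S : finType) (w : Dpairs S -> R) :
    set (Dpairs S -> R) :=
  real_class (@Phi R S) w.

(* L_0 = I + J with J = {0..r} x {1..d}; the second index is shifted to
   {0..d-1}. *)
Definition L0 (I : finType) (r d : nat) : finType := (I + 'I_r.+1 * 'I_d)%type.

Section AlgebraicCurves.
Variable K : fieldType.

(* Binary forms of degree d, given by their coefficients. *)
Definition form_eval (d : nat) (c : 'I_d.+1 -> K) (y : K * K) : K :=
  \sum_(k < d.+1) c k * y.1 ^+ (d - k) * y.2 ^+ k.

(* For p = (b : a) and q = (b' : a'), this is b a' - a b'; it vanishes iff
   p = q in P^1. *)
Definition cross (p q : K * K) : K := p.1 * q.2 - p.2 * q.1.

(* Representatives of the elements of M^lab_{0,I}(r,d): C = P^1, the marked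
   points have homogeneous coordinates [mark], and f is the morphism given by
   r+1 binary forms of degree d without common zero, i.e. f^*O(1) = O(d), which
   says that f_*[C] has degree d. *)
Record lab_curve (I : finType) (r d : nat) := LabCurve {
  mark : L0 I r d -> K * K;
  mark_neq0 : forall l, mark l != (0, 0);
  mark_distinct : forall l m, l != m -> cross (mark l) (mark m) != 0;
  forms : 'I_r.+1 -> 'I_d.+1 -> K;
  forms_base_free : forall y : K * K, y != (0, 0) ->
    exists k, form_eval (forms k) y != 0;
  forms_zeros : forall (k : 'I_r.+1) (y : K * K), y != (0, 0) ->
    (form_eval (forms k) y = 0 <->
     exists j : 'I_d, cross y (mark (inr (k, j))) = 0)
}.

Variables (I : finType) (r d : nat).

Definition ev (C : lab_curve I r d) (i : I) : 'I_r.+1 -> K :=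
  fun k => form_eval (forms C k) (mark C (inl i)).

Definition cross_coords (C : lab_curve I r d) : Dpairs (L0 I r d) -> K :=
  fun q => cross (mark C (val q).1) (mark C (val q).2).

Lemma ev_neq0 (C : lab_curve I r d) (i : I) (k : 'I_r.+1) : ev C i k != 0.
Proof.
apply/eqP => /(forms_zeros C k (mark_neq0 C (inl i)))[j].
by apply/eqP; apply: mark_distinct.
Qed.

Definition trop_embedding (R : realType) (nu : K -> \bar R) (i0 : I)
    (C : lab_curve I r d) :
    set (Dpairs (L0 I r d) -> R) * set ('I_r.+1 -> R) :=
  (tropD nu (cross_coords C), tropT nu (ev C i0)).

End AlgebraicCurves.

Section TropicalCurves.
Variable R : realType.

Definition valence (V : finType) (adj : rel V) (v : V) : nat :=
  #|[set w | adj v w]%SET|.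

(* Abstract rational tropical curves.  The edges are the pairs {v, w} with
   [adj v w]; the values of [len] on other pairs are irrelevant. *)
Record trop_tree := TropTree {
  vert : finType;
  adj : rel vert;
  len : vert -> vert -> \bar R;
  adj_sym : symmetric adj;
  adj_irr : irreflexive adj;
  tree_connected : forall v w, connect adj v w;
  tree_acyclic : forall c : seq vert, ucycle adj c -> (size c <= 2)%N;
  len_sym : forall v w, len v w = len w v;
  len_gt0 : forall v w, adj v w -> (0 < len v w)%E;
  valence_neq2 : forall v, valence adj v != 2%N;
  card_vert_neq2 : #|vert| != 2%N;
  len_infty : forall v w, adj v w ->
    (len v w = +oo%E <-> valence adj v = 1%N \/ valence adj w = 1%N)
}.

Definition inner (T : trop_tree) (v : vert T) : bool :=
  valence (@adj T) v != 1%N.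

Definition simple_path (T : trop_tree) (v w : vert T) : pred (seq (vert T)) :=
  fun p => [&& path (@adj T) v p, last v p == w & uniq (v :: p)].

Lemma simple_path_ex (T : trop_tree) (v w : vert T) :
  exists p, simple_path v w p.
Proof.
have /connectP[p vp ->] := tree_connected v w.
have [p' vp' up' _] := shortenP vp.
by exists p'; rewrite /simple_path vp' up' eqxx.
Qed.

Definition path_length (T : trop_tree) (v : vert T) (p : seq (vert T)) : R :=
  \sum_(e <- zip (v :: p) p) fine (len e.1 e.2).

(* In a tree the simple path chosen here is the only one; between inner
   vertices all its edges have finite length. *)
Definition vdist (T : trop_tree) (v w : vert T) : R :=
  path_length v (xchoose (simple_path_ex v w)).

(* Representatives of the elements of the tropical M^lab_{0,I}(r,d).  The leg
   e_l joins the inner vertex [base l] to the foot [foot l].  The map f is given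
   by the images of the inner vertices (vectors of R^(r+1) representing points of
   R^(r+1)/R(1,...,1)) and by the direction vectors: the point at distance t from
   the inner vertex v on the edge {v, w} is sent to pos v + t * dir v w, and
   [pos_affine] says that this is consistent at the other end of a bounded
   edge.  The values of [pos] at feet and of [dir] from feet are irrelevant. *)
Record lab_trop_curve (I : finType) (r d : nat) := LabTropCurve {
  tree :> trop_tree;
  base : L0 I r d -> vert tree;
  foot : L0 I r d -> vert tree;
  leg_adj : forall l, adj (base l) (foot l);
  foot_inj : injective foot;
  footP : forall v, valence (@adj tree) v = 1%N <-> exists l, foot l = v;
  pos : vert tree -> 'I_r.+1 -> R;
  dir : vert tree -> vert tree -> 'I_r.+1 -> int;
  pos_affine : forall v w, adj v w -> inner v -> inner w ->
    classT (pos w) = classT (fun k => pos v k + fine (len v w) * (dir v w k)%:~R);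
  balanced : forall v, inner v ->
    classN R (fun k => \sum_(w | adj v w) dir v w k) = classN R (fun=> 0);
  dir_J : forall (k : 'I_r.+1) (j : 'I_d),
    classN R (dir (base (inr (k, j))) (foot (inr (k, j)))) =
    classN R (std_vec k);
  dir_I : forall i : I,
    classN R (dir (base (inl i)) (foot (inl i))) = classN R (fun=> 0)
}.

Variables (I : finType) (r d : nat).

(* The leg e_i has direction 0, so it is contracted to the image of its inner
   vertex. *)
Definition trop_ev (T : lab_trop_curve I r d) (i : I) : set ('I_r.+1 -> R) :=
  classT (pos (base T (inl i))).

Definition leg_dist (T : lab_trop_curve I r d) (l m : L0 I r d) : R :=
  vdist (base T l) (base T m).

Definition embedding (i0 : I) (T : lab_trop_curve I r d) :
    set (Dpairs (L0 I r d) -> R) * set ('I_r.+1 -> R) :=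
  (classD (fun q => - leg_dist T (val q).1 (val q).2 / 2), trop_ev T i0).

End TropicalCurves.

(* Main.v *)
(* Algebraic side: the form f_k vanishes exactly at the d points p_kj, so
   f_k(p_i) / f_k(p_i0) is the product over j of cross(p_i, p_kj) / cross(p_i0, p_kj).
   Hence the difference of trop (ev_i) and trop (ev_i0) is a sum of valuations of
   cross-ratios, which the first component of the embedding expresses through
   the distances -dist/2.

   Tropical side: the function
     pos_k - pos_l + (sum_j dist(-, base kj) - sum_j dist(-, base lj)) / 2
   is constant on inner vertices.  Its weighted Laplacian vanishes: by balancing,
   the first part contributes minus the number of legs kj at v plus the number of
   legs lj at v, while v |-> dist(v, a) has Laplacian deg(v) - 2 + 2 [v = a] on a
   tree, and both distance sums have d terms. *)

Require Import Defs.
From mathcomp Require Import all_boot all_order all_algebra.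
From mathcomp Require Import classical_sets reals constructive_ereal.
From mathcomp Require Import ring lra zify.

Set Implicit Arguments.
Unset Strict Implicit.
Unset Printing Implicit Defensive.

Import Order.TTheory GRing.Theory Num.Theory.

Local Open Scope ring_scope.

(** * Paths, distances and harmonic functions on metric trees *)

Section Trees.
Variables (R : realType) (T : trop_tree R).
Local Notation V := (vert T).
Local Notation adj := (@adj R T).
Implicit Types (u v w a : V) (p q : seq V).

Lemma simple_path_cons v w a p :
  simple_path v a (w :: p) =
  [&& adj v w, v \notin w :: p & simple_path w a p].
Proof.
rewrite /simple_path [path _ v _]/= [last v _]/= [uniq _]/= -!andbA.
by case: (adj v w); case: (path _ w p); case: (v \in _); case: (last w p == a).
Qed.

(** If [w] came later on the path, the edge from [w] back to [v] would close a cycle with at least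
    three vertices. *)
Lemma neighbour_on_path v w a p :
  simple_path v a p -> adj v w -> w \in p -> w = head v p.
Proof.
case: p => // u p /and3P[pth _ un] vw wp; apply/eqP; apply/negPn/negP => /= neq.
move: wp; rewrite inE (negbTE neq) /= => wp.
move: pth un; case/path.splitP: {p} wp => p1 p2.
rewrite -cat_cons cat_path => /andP[pth _].
rewrite -cat_cons cat_uniq => /andP[un _].
have : ucycle adj (v :: u :: rcons p1 w).
  rewrite /ucycle un andbT (cycle_path v) /= last_rcons.
  by rewrite adj_sym vw; move: pth => /=.
by move/tree_acyclic; rewrite /= size_rcons.
Qed.

(** Induction on [p]. If [q] also passes through its first vertex [w], then [q] starts with [w] and
    the tails agree. Otherwise [v :: q] is a simple path from [w], so it equals the tail of [p],
    which avoids [v]. *)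
Lemma simple_path_uniq v a p q :
  simple_path v a p -> simple_path v a q -> p = q.
Proof.
elim: p v q => [|w p IH] v q.
  case/and3P=> _ /eqP /= <- _; case: q => // u q.
  by case/and3P=> _ /= /eqP <-; rewrite mem_last.
move=> sp sq; move: (sp); rewrite simple_path_cons => /and3P[vw vp swp].
have [wq|wq] := boolP (w \in q).
  have := neighbour_on_path sq vw wq.
  case: q sq wq => // u q sq _ /= eu; rewrite -{u}eu in sq *.
  congr (_ :: _); apply: IH swp _.
  by move: sq; rewrite simple_path_cons => /and3P[].
have wv : w != v by apply: contraTneq vw => ->; rewrite adj_irr.
have : simple_path w a (v :: q).
  by rewrite simple_path_cons adj_sym vw inE negb_or wv wq sq.
by move/(IH _ _ swp) => ep; rewrite ep !inE eqxx orbT in vp.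
Qed.

Lemma vdistE v a p : simple_path v a p -> vdist v a = path_length v p.
Proof.
by move=> sp; rewrite /vdist (simple_path_uniq (xchooseP (simple_path_ex v a)) sp).
Qed.

Lemma path_length_cons v w p :
  path_length v (w :: p) = fine (len v w) + path_length w p.
Proof. by rewrite /path_length /= big_cons. Qed.

Lemma vdist_toward v w a p :
  simple_path v a (w :: p) -> vdist w a = vdist v a - fine (len v w).
Proof.
move=> sp; rewrite (vdistE sp) path_length_cons.
move: sp; rewrite simple_path_cons => /and3P[_ _ /vdistE ->].
by rewrite addrAC subrr add0r.
Qed.

Lemma vdist_away v w a p : simple_path v a p -> adj v w -> w \notin p ->
  vdist w a = vdist v a + fine (len v w).
Proof.
move=> sp vw wp; rewrite (vdistE sp).
have wv : w != v by apply: contraTneq vw => ->; rewrite adj_irr.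
have /vdistE -> : simple_path w a (v :: p).
  by rewrite simple_path_cons adj_sym vw inE negb_or wv wp sp.
by rewrite path_length_cons addrC len_sym.
Qed.

(** Unless [w] is the inner end [a] itself, its two neighbours on the path are distinct, so its
    valence is not 1. *)
Lemma path_head_inner v w a p :
  simple_path v a (w :: p) -> inner a -> inner w.
Proof.
case: p => [/and3P[_ /eqP /= <-] //|u p sp _].
move: sp; rewrite simple_path_cons => /and3P[vw vp].
rewrite simple_path_cons => /and3P[wu _ _].
rewrite /inner /valence; apply/negP => /cards1P[x ex].
have vx : v = x by apply/set1P; rewrite -ex inE adj_sym.
have ux : u = x by apply/set1P; rewrite -ex inE.
by rewrite ux -vx !inE eqxx !orbT in vp.
Qed.

(** Since [fine] sends infinity to 0, finiteness is the point: an infinite edge has an end of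
    valence 1. *)
Lemma inner_len v w : adj v w -> inner v -> inner w -> 0 < fine (len v w).
Proof.
move=> vw iv iw; have := len_gt0 vw; have := len_infty vw.
case: (len v w) => [x| |] //= [h _] _.
by have [] := h erefl => /eqP; [rewrite (negbTE iv)|rewrite (negbTE iw)].
Qed.

(** Inverse length as edge weight, as in an electrical network. The value 0 at feet and off edges
    allows sums over all vertices and makes the weight symmetric. *)
Definition conductance v w : R :=
  if [&& adj v w, inner v & inner w] then (fine (len v w))^-1 else 0.

Lemma conductance_ge0 v w : 0 <= conductance v w.
Proof.
rewrite /conductance; case: ifP => // /and3P[vw iv iw].
by rewrite invr_ge0 ltW ?inner_len.
Qed.

Lemma conductance_sym v w : conductance v w = conductance w v.
Proof. by rewrite /conductance len_sym adj_sym [inner v && _]andbC. Qed.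

Lemma sum_conductance v (F : V -> R) : inner v ->
  \sum_w conductance v w * F w =
  \sum_(w | adj v w && inner w) F w / fine (len v w).
Proof.
move=> iv; rewrite [RHS]big_mkcond; apply: eq_bigr => w _.
by rewrite /conductance iv; case: ifP => _; rewrite ?mul0r // mulrC.
Qed.

(** Along the edge towards [a] the distance has slope -1, along every other edge at [v] slope 1. For
    [v = a] no edge leads towards [a], which adds the 2. *)
Lemma vdist_laplacian v a : inner v -> inner a ->
  \sum_w conductance v w * (vdist w a - vdist v a) =
  #|[pred w | adj v w && inner w]|%:R - 2 + 2 * (a == v)%:R.
Proof.
move=> iv ia; rewrite sum_conductance //.
have [p sp] := simple_path_ex v a.
case: p sp => [|u p] sp.
  have av : a = v by case/and3P: sp => _ /= /eqP.
  rewrite av eqxx mulr1 subrK -sum1_card natr_sum; apply: eq_bigr => w /andP[vw iw].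
  move: sp; rewrite av => sp; rewrite (vdist_away sp vw) //.
  by rewrite [X in X / _]addrC addKr divff // gt_eqF ?inner_len.
have vu : adj v u by move: sp; rewrite simple_path_cons => /andP[].
have iu := path_head_inner sp ia.
have av : a == v = false.
  apply: contraTF sp => /eqP ->; rewrite /simple_path; apply/negP => /and3P[_ /eqP /= ev].
  by rewrite -{1}ev mem_last.
rewrite av mulr0 addr0 -sum1_card natr_sum.
rewrite (bigD1 u) ?vu //= [in RHS](bigD1 u) ?inE ?vu //=.
rewrite (vdist_toward sp) [X in X / _]addrC addKr mulNr divff ?gt_eqF ?inner_len //.
rewrite (eq_bigr (fun=> 1)); first by ring.
move=> w /andP[/andP[vw iw] wu].
rewrite (vdist_away sp vw); last by apply: contra_neqN wu => /(neighbour_on_path sp vw).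
by rewrite [X in X / _]addrC addKr divff // gt_eqF ?inner_len.
Qed.

(* Summation by parts shows that the Dirichlet energy, the sum of
   conductance v w * (h w - h v)^2, vanishes. *)
Lemma harmonic_const (h : V -> R) :
  (forall v, inner v -> \sum_w conductance v w * (h w - h v) = 0) ->
  forall v w, inner v -> inner w -> h v = h w.
Proof.
move=> harm.
(* All conductances at a foot vanish, so the equation holds at every vertex. *)
have harm' v : \sum_w conductance v w * (h w - h v) = 0.
  case: (boolP (inner v)) => [/harm //|iv].
  by rewrite big1 // => w _; rewrite /conductance (negbTE iv) andbF mul0r.
have E0 : \sum_v \sum_w conductance v w * (h w - h v) ^+ 2 = 0.
  transitivity (\sum_v \sum_w conductance v w * (h w - h v) * h w
     - \sum_v \sum_w conductance v w * (h w - h v) * h v).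
    rewrite -sumrB; apply: eq_bigr => v _; rewrite -sumrB; apply: eq_bigr => w _.
    by rewrite expr2 mulrA mulrBr.
  rewrite [X in X - _]exchange_big /= -sumrB big1 // => v _.
  rewrite -[X in _ - X]mulr_suml harm' mul0r subr0.
  transitivity (- ((\sum_w conductance v w * (h w - h v)) * h v)).
    rewrite mulr_suml -sumrN; apply: eq_bigr => w _.
    by rewrite conductance_sym -mulNr -mulrN opprB.
  by rewrite harm' mul0r oppr0.
have edge v w : adj v w -> inner v -> inner w -> h v = h w.
  move=> vw iv iw.
  have ge0 x y : 0 <= conductance x y * (h y - h x) ^+ 2.
    by rewrite mulr_ge0 ?conductance_ge0 ?sqr_ge0.
  move/eqP: E0; rewrite psumr_eq0 => [|x _]; last exact: sumr_ge0.
  move/allP/(_ v (mem_index_enum _)) => /=; rewrite psumr_eq0 //.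
  move/allP/(_ w (mem_index_enum _)) => /=.
  rewrite mulf_eq0 expf_eq0 subr_eq0 /conductance vw iv iw invr_eq0.
  by rewrite gt_eqF ?inner_len //= => /eqP.
move=> v w iv iw; have [p] := simple_path_ex v w.
elim: p v iv => [|u p IH] v iv; first by case/and3P => _ /eqP /= ->.
move=> sp; have iu := path_head_inner sp iw.
move: sp; rewrite simple_path_cons => /and3P[vu _ su].
by rewrite (edge v u) // (IH u).
Qed.

End Trees.

(** * Valuations of products and powers *)

Section Valuation.
Variables (R : realType) (K : fieldType) (nu : K -> \bar R).
Hypothesis hnu : is_valuation nu.
Local Notation v x := (fine (nu x)).
Implicit Types x y : K.

Lemma fine_valM x y : x != 0 -> y != 0 -> v (x * y) = v x + v y.
Proof. by move=> x0 y0; rewrite (Defs.valM hnu) fineD ?(val_fin hnu). Qed.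

Lemma fine_val1 : v 1 = 0.
Proof.
have := fine_valM (oner_neq0 K) (oner_neq0 K); rewrite mulr1 => /eqP.
by rewrite -subr_eq subrr eq_sym => /eqP.
Qed.

Lemma fine_valV x : x != 0 -> v x^-1 = - v x.
Proof.
move=> x0; apply/eqP; rewrite -addr_eq0 -fine_valM ?invr_eq0 //.
by rewrite mulVf // fine_val1.
Qed.

Lemma fine_val_prod (X : finType) (x : X -> K) : (forall k, x k != 0) ->
  v (\prod_k x k) = \sum_k v (x k).
Proof.
move=> x0.
(* Nonvanishing is carried through the induction, because [fine] is additive only on finite
   values. *)
have [] // : \prod_k x k != 0 /\ v (\prod_k x k) = \sum_k v (x k).
apply: (big_ind2 (fun y z => y != 0 /\ v y = z)) => [|y a z b [y0 <-] [z0 <-]|k _].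
- by rewrite oner_neq0 fine_val1.
- by rewrite mulf_neq0 // fine_valM.
- by rewrite x0.
Qed.

Lemma fine_valX x (n : int) : x != 0 -> v (x ^ n) = v x *~ n.
Proof.
move=> x0; have pos m : v (x ^+ m) = v x *+ m.
  elim: m => [|m IH]; first by rewrite expr0 fine_val1.
  by rewrite exprS mulrS fine_valM ?expf_neq0 // IH.
case: n => m; first by rewrite -exprnP pos.
by rewrite NegzE -invr_expz -exprnP fine_valV ?expf_neq0 // pos mulrNz.
Qed.

End Valuation.

(** * Tropicalization of quotient tori, tested on characters *)

Section Characters.
Variables (R : realType) (K : fieldType) (nu : K -> \bar R) (X Y : finType).
Hypothesis hnu : is_valuation nu.
Variable act : (Y -> K) -> X -> K.

Lemma tropP (x : X -> K) (w : X -> R) : (forall k, x k != 0) ->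
  trop nu act x w <-> forall m, characters act m ->
    \sum_k w k *~ m k = \sum_k fine (nu (x k)) *~ m k.
Proof.
move=> x0; have E m : fine (nu (\prod_k x k ^ m k)) = \sum_k fine (nu (x k)) *~ m k.
  rewrite fine_val_prod // => [|k]; last by rewrite expfz_neq0.
  by apply: eq_bigr => k _; rewrite fine_valX.
by split=> h m /h; rewrite E.
Qed.

End Characters.


(** Exponent vector of the coordinate function at [q]; the test characters below are combinations of
    these. *)
Definition pointmass (X : finType) (q : X) : X -> int := fun k => (k == q)%:R.

Section PointMass.
Variables (X : finType).

Lemma sum_mulzD (V : zmodType) (w : X -> V) (m n : X -> int) :
  \sum_k w k *~ (m k + n k) = \sum_k w k *~ m k + \sum_k w k *~ n k.
Proof. by rewrite -big_split; apply: eq_bigr => k _; rewrite mulrzDr. Qed.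

Lemma sum_mulzB (V : zmodType) (w : X -> V) (m n : X -> int) :
  \sum_k w k *~ (m k - n k) = \sum_k w k *~ m k - \sum_k w k *~ n k.
Proof. by rewrite -sumrB; apply: eq_bigr => k _; rewrite mulrzBr. Qed.

Lemma sum_pointmass (V : zmodType) (w : X -> V) (q : X) :
  \sum_k w k *~ pointmass q k = w q.
Proof.
rewrite (bigD1 q) //= /pointmass eqxx big1 ?addr0 // => k /negbTE ->.
by rewrite mulr0z.
Qed.

Variables (K : fieldType) (x : X -> K).

Lemma prod_pointmass (q : X) : \prod_k x k ^ pointmass q k = x q.
Proof.
rewrite (bigD1 q) //= /pointmass eqxx expr1z big1 ?mulr1 // => k /negbTE ->.
by rewrite expr0z.
Qed.

Hypothesis x0 : forall k, x k != 0.

Lemma prod_expzD (m n : X -> int) :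
  \prod_k x k ^ (m k + n k) = \prod_k x k ^ m k * \prod_k x k ^ n k.
Proof. by rewrite -big_split; apply: eq_bigr => k _; rewrite expfzDr. Qed.

Lemma prod_expzB (m n : X -> int) :
  \prod_k x k ^ (m k - n k) = \prod_k x k ^ m k / \prod_k x k ^ n k.
Proof.
rewrite prod_expzD -prodfV; congr (_ * _); apply: eq_bigr => k _.
by rewrite invr_expz.
Qed.

End PointMass.

Section TropT.
Variables (R : realType) (K : fieldType) (nu : K -> \bar R) (r : nat).
Hypothesis hnu : is_valuation nu.
Variable x : 'I_r.+1 -> K.
Hypothesis x0 : forall k, x k != 0.

(** The quotient of the coordinates [k] and [l] is a character, being invariant under scaling. *)
Lemma tropT_const (w : 'I_r.+1 -> R) : tropT nu x w ->
  forall k l, w k - fine (nu (x k)) = w l - fine (nu (x l)).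
Proof.
move=> /(tropP hnu _ _ x0) h k l.
have := h (fun q => pointmass k q - pointmass l q).
rewrite !sum_mulzB !sum_pointmass => E.
suff : w k - w l = fine (nu (x k)) - fine (nu (x l)) by lra.
apply: E; move=> t t0; rewrite prod_expzB => [|q]; last exact: t0.
by rewrite !prod_pointmass divff // t0.
Qed.

(** On the diagonal a character is a power of the scaling factor. Scaling by 2 suffices: in
    characteristic 0 it is not a root of unity, as [2 ^ n - 1] is a nonzero natural number for
    [n > 0]. *)
Lemma character_diag_sum0 (m : 'I_r.+1 -> int) : [pchar K] =i pred0 ->
  characters (@diag_act K r) m -> \sum_k m k = 0.
Proof.
move=> char0 cm.
have n0 n : n.+1%:R != 0 :> K by rewrite ((pcharf0P K).1 char0).
have := cm (fun=> 2%:R) (fun=> n0 1%N).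
have -> : \prod_k diag_act (fun=> 2%:R : K) k ^ m k = 2%:R ^ (\sum_k m k).
  apply: (big_ind2 (fun y n => y = (2%:R : K) ^ n)) => //.
  by move=> a b c e -> ->; rewrite expfzDr.
have pow n : (2%:R : K) ^+ n = 1 -> n = 0%N.
  move/eqP; rewrite -natrX -subr_eq0 -(natrB _ (expn_gt0 2 n)).
  rewrite ((pcharf0P K).1 char0) subn_eq0 -{2}(expn0 2) leq_exp2l // leqn0.
  by move/eqP.
case: (\sum_k m k) => n; first by move/pow->.
by rewrite NegzE -invr_expz => /eqP; rewrite invr_eq1 => /eqP/pow.
Qed.

Lemma classT_tropT (w : 'I_r.+1 -> R) : [pchar K] =i pred0 ->
  (forall k l, w k - fine (nu (x k)) = w l - fine (nu (x l))) ->
  classT w = tropT nu x.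
Proof.
move=> char0 hw; apply/seteqP; split=> u.
  case=> t ut; apply/(tropP hnu _ _ x0) => m cm.
  (* By [hw] the vector [u] differs from the valuations by a constant, and a constant is invisible
     to exponents with sum 0. *)
  have -> : \sum_k u k *~ m k =
     \sum_k (fine (nu (x k)) *~ m k + (w ord0 - fine (nu (x ord0)) + t tt) *~ m k).
    apply: eq_bigr => k _; rewrite -mulrzDl ut /diag_act; congr (_ *~ _).
    by rewrite -(hw k); lra.
  rewrite big_split /= -mulrz_sumr.
 
  by rewrite (character_diag_sum0 char0 cm) mulr0z addr0.
move/tropT_const => hu; exists (fun=> u ord0 - w ord0) => k.
by rewrite /diag_act; have := hu k ord0; have := hw k ord0; lra.
Qed.

End TropT.

(** The cross-ratio of [a], [b], [c], [e] is a character: each of the four indices occurs once in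
    the numerator and once in the denominator, so [pair_act] cancels. *)
Lemma tropD_quad (R : realType) (K : fieldType) (nu : K -> \bar R) (S : finType)
    (x : Dpairs S -> K) (w : Dpairs S -> R) (a b c e : S)
    (ac : a != c) (ae : a != e) (bc : b != c) (be : b != e) :
  is_valuation nu -> (forall q, x q != 0) -> tropD nu x w ->
  let P f := f (exist _ (a, c) ac) + f (exist _ (b, e) be)
           - (f (exist _ (a, e) ae) + f (exist _ (b, c) bc)) in
  P w = P (fun q => fine (nu (x q))) :> R.
Proof.
move=> hnu x0 /(tropP hnu _ _ x0) h P.
set q1 : Dpairs S := exist _ (a, c) ac; set q2 : Dpairs S := exist _ (b, e) be.
set q3 : Dpairs S := exist _ (a, e) ae; set q4 : Dpairs S := exist _ (b, c) bc.
have := h (fun q => (pointmass q1 q + pointmass q2 q)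
                   - (pointmass q3 q + pointmass q4 q)).
rewrite !(sum_mulzB, sum_mulzD) !sum_pointmass; apply=> t t0.
have u0 q : pair_act t q != 0 by rewrite mulf_neq0.
rewrite prod_expzB // !prod_expzD // !prod_pointmass /pair_act /=.
by field; rewrite !t0.
Qed.


(** * Binary forms and their factorization along a line *)

Lemma top_coefM (A : comNzRingType) (p q : {poly A}) (m n : nat) :
  (size p <= m.+1)%N -> (size q <= n.+1)%N ->
  (size (p * q)%R <= (m + n).+1)%N /\ (p * q)`_(m + n) = p`_m * q`_n.
Proof.
move=> sp sq; split.
  apply: leq_trans (size_polyMleq p q) _.
  by rewrite -subn1 leq_subLR add1n -addnS -addSn leq_add.
have mn : (m < (m + n).+1)%N by lia.
(* Any index other than [m] puts one of the two factors beyond its degree bound. *)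
rewrite coefM (bigD1 (Ordinal mn)) //= addKn big1 ?addr0 // => j /eqP jm.
have [lt|ge] := ltnP m j.
  by rewrite [p`__]nth_default ?mul0r // (leq_trans sp).
rewrite [q`__]nth_default ?mulr0 // (leq_trans sq) //.
have : nat_of_ord j <> m by move=> e; apply: jm; apply: val_inj.
by lia.
Qed.

Lemma top_coefX (A : comNzRingType) (p : {poly A}) (n : nat) :
  (size p <= 2)%N -> (size (p ^+ n)%R <= n.+1)%N /\ (p ^+ n)`_n = p`_1 ^+ n.
Proof.
move=> sp; elim: n => [|n [IH1 IH2]].
  by rewrite !expr0 size_poly1 coef1.
by rewrite !exprS -IH2; have := top_coefM sp IH1; rewrite add1n.
Qed.

Section Forms.
Variables (K : fieldType) (d : nat) (c : 'I_d.+1 -> K).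

(* Restricted to the line y + t z, the form is a polynomial in t with constant
   term c(y), leading term c(z) and one root on the line through each p j. *)
Lemma form_ratio (y z : K * K) (p : 'I_d -> K * K) :
  form_eval c z != 0 ->
  (forall j, cross y (p j) != 0) -> (forall j, cross z (p j) != 0) ->
  (forall j k, j != k -> cross (p j) (p k) != 0) ->
  (forall u, u != (0, 0) -> (exists j, cross u (p j) = 0) -> form_eval c u = 0) ->
  cross y z != 0 ->
  form_eval c y * \prod_j cross z (p j) = form_eval c z * \prod_j cross y (p j).
Proof.
move=> cz0 y0 z0 p0 c0 yz.
pose l1 := y.1%:P + z.1 *: 'X : {poly K}.
pose l2 := y.2%:P + z.2 *: 'X : {poly K}.
pose P := \sum_(k < d.+1) (c k)%:P * l1 ^+ (d - k) * l2 ^+ k.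
have PE t : P.[t] = form_eval c (y.1 + z.1 * t, y.2 + z.2 * t).
  rewrite horner_sum; apply: eq_bigr => k _.
  by rewrite !hornerE.
have sz (a b : K) : (size (a%:P + b *: 'X)%R <= 2)%N.
  rewrite (leq_trans (size_polyD _ _)) // geq_max.
  rewrite (leq_trans (size_polyC_leq1 _)) //.
  by rewrite (leq_trans (size_scale_leq _ _)) // size_polyX.
have c1 (a b : K) : (a%:P + b *: 'X)`_1 = b.
  by rewrite coefD coefC coefZ coefX mulr1 add0r.
(* A coordinate of [z] may vanish, so [l1] or [l2] may be constant. Hence only degree bounds and
   coefficients at the formal degree are tracked. *)
have top k : (k <= d)%N ->
   (size (l1 ^+ (d - k) * l2 ^+ k)%R <= d.+1)%N /\
   (l1 ^+ (d - k) * l2 ^+ k)`_d = z.1 ^+ (d - k) * z.2 ^+ k.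
  move=> kd; have [s1 e1] := top_coefX (d - k) (sz y.1 z.1).
  have [s2 e2] := top_coefX k (sz y.2 z.2).
  have := top_coefM s1 s2; rewrite subnK // e1 e2 !c1; exact.
have sP : (size P <= d.+1)%N.
  apply: (leq_trans (size_sum _ _ _)); apply/bigmax_leqP => k _.
  have /top[s1 _] : (k <= d)%N by rewrite -ltnS.
  by rewrite -mulrA mul_polyC (leq_trans (size_scale_leq _ _)).
have dP : P`_d = form_eval c z.
  rewrite coef_sum; apply: eq_bigr => k _.
  have /top[_ e1] : (k <= d)%N by rewrite -ltnS.
  by rewrite -mulrA coefCM e1 mulrA.
have eP : size P = d.+1.
  by apply/eqP; rewrite eqn_leq sP ltnNge; apply: contra cz0 => s; rewrite -dP nth_default.
(* The parameter at which the line [y + t z] meets [p j], found from linearity of [cross] in its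
   first argument. *)
pose t j := - (cross y (p j) / cross z (p j)).
have crossE u s : cross (y.1 + z.1 * s, y.2 + z.2 * s) u = cross y u + s * cross z u.
  by rewrite /cross /=; ring.
have rootP j : root P (t j).
  rewrite /root PE; apply/eqP/c0.
    apply: contra yz => /eqP[e1 e2].
    suff -> : cross y z = (y.1 + z.1 * t j) * z.2 - z.1 * (y.2 + z.2 * t j).
      by rewrite e1 e2 mul0r mulr0 subrr.
    by rewrite /cross; ring.
  by exists j; rewrite crossE /t mulNr divfK // subrr.
(* Two equal parameters would contradict the Plücker relation between [y], [z], [p j] and [p k],
   given that [cross y z] and [cross (p j) (p k)] are nonzero. *)
have uniqt : uniq [seq t j | j <- enum 'I_d].
  rewrite map_inj_uniq ?enum_uniq // => j k /oppr_inj /eqP.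
  rewrite eqr_div // => /eqP e; apply/eqP/negPn/negP => /p0 /negP; apply.
  rewrite -(mulIr_eq0 _ (mulIf yz)); apply/eqP.
  suff -> : cross (p j) (p k) * cross y z =
     cross y (p j) * cross z (p k) - cross y (p k) * cross z (p j).
    by rewrite e subrr.
  by rewrite /cross; ring.
(* The degree is exactly [d], so the [d] distinct roots give the full factorization; evaluating it
   at 0 then yields the claim. *)
have := @all_roots_prod_XsubC _ P [seq t j | j <- enum 'I_d].
rewrite size_map size_enum_ord => /(_ eP) E.
have {}E : P = lead_coef P *: \prod_(z <- [seq t j | j <- enum 'I_d]) ('X - z%:P).
  apply: E; last by rewrite uniq_rootsE.
  by apply/allP => _ /mapP[j _ ->].
have := PE 0; rewrite !mulr0 !addr0 -surjective_pairing => <-.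
rewrite E hornerZ horner_prod big_map lead_coefE eP dP -mulrA; congr (_ * _).
rewrite big_enum -big_split /=; apply: eq_bigr => j _.
by rewrite !hornerE /t opprK divfK.
Qed.
End Forms.

(** * Classes of real vectors, balancing, and the harmonic potential of a tropical curve *)

Lemma mem_real_class (R : realType) (X Y : finType) (lin : (Y -> R) -> X -> R)
    (w : X -> R) : (forall k, lin (fun=> 0) k = 0) -> real_class lin w w.
Proof. by move=> l0; exists (fun=> 0) => k; rewrite l0 addr0. Qed.

Lemma classT_const (R : realType) (r : nat) (u w : 'I_r.+1 -> R) :
  classT u = classT w -> forall k l, u k - u l = w k - w l.
Proof.
move=> e k l; have : classT u u by exact: mem_real_class.
by rewrite e => -[t ut]; rewrite !ut /diag_act; ring.
Qed.

Section TropicalCurve.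
Variables (R : realType) (I : finType) (r d : nat) (T : lab_trop_curve R I r d).
Local Notation V := (vert T).
Local Notation adj := (@adj R T).
Implicit Types (u v w : V) (a : L0 I r d) (k l : 'I_r.+1).

Lemma leaf_uniq_neighbour v w u : ~~ inner w -> adj w v -> adj w u -> u = v.
Proof.
rewrite negbK => /cards1P[x ex] wv wu.
have /set1P-> : u \in [set x] by rewrite -ex inE.
by apply/esym/set1P; rewrite -ex inE.
Qed.

Lemma foot_leaf a : ~~ inner (foot T a).
Proof. by rewrite negbK; apply/eqP/footP; exists a. Qed.

(** If the base were 1-valent too, no walk could leave the leg; by connectedness the tree would have
    just two vertices, which [card_vert_neq2] excludes. *)
Lemma base_inner a : inner (base T a).
Proof.
have [//|nb] := boolP (inner (base T a)).
have := card_vert_neq2 T; apply: contraNT => _.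
have bf := leg_adj T a; have fb : adj (foot T a) (base T a) by rewrite adj_sym.
have walk p : forall y, y \in [set base T a; foot T a] -> path adj y p ->
    last y p \in [set base T a; foot T a].
  elim: p => [|x p IH] y //= hy /andP[yx]; apply: IH.
  move: hy yx; rewrite !inE => /orP[]/eqP-> yx.
    by rewrite (leaf_uniq_neighbour nb bf yx) eqxx orbT.
  by rewrite (leaf_uniq_neighbour (foot_leaf a) fb yx) eqxx.
have cl u : u \in [set base T a; foot T a].
  by have /connectP[p pth ->] := tree_connected (base T a) u; rewrite walk // set21.
have neq : base T a != foot T a by apply: contraTneq bf => <-; rewrite adj_irr.
apply/eqP; transitivity #|[set base T a; foot T a]|; last by rewrite cards2 neq.
by rewrite -cardsT; congr #|pred_of_set _|; apply/setP => u; rewrite cl inE.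
Qed.

(** Directions are given modulo the diagonal, so only differences of two coordinates are
    meaningful. *)
Lemma dir_foot k l a :
  ((dir (base T a) (foot T a) k)%:~R - (dir (base T a) (foot T a) l)%:~R : R) =
  if a is inr (i, _) then (i == k)%:R - (i == l)%:R else 0.
Proof.
case: a => [i|[i j]].
  by rewrite (classT_const (dir_I T i) k l) subrr.
rewrite (classT_const (dir_J T i j) k l) /std_vec !(eq_sym _ i).
by do 2!case: (_ == _).
Qed.

Definition legs_at k v : nat := #|[pred j : 'I_d | base T (inr (k, j)) == v]|.

Lemma sum_inner_dir k l v : inner v ->
  \sum_(w | adj v w && inner w) ((dir v w k)%:~R - (dir v w l)%:~R) =
  (legs_at l v)%:R - (legs_at k v)%:R :> R.
Proof.
move=> iv.
have : \sum_(w | adj v w) ((dir v w k)%:~R - (dir v w l)%:~R : R) = 0.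
  have := classT_const (balanced iv) k l.
  by rewrite sumrB !rmorph_sum /= => ->; rewrite subrr.
rewrite (bigID (@inner R T)) /= => /eqP; rewrite addr_eq0 => /eqP ->.
(* The neighbours of [v] that are not inner are exactly the feet of the legs based at [v], so the
   sum can run over these legs. *)
rewrite (eq_bigl (mem [set foot T a | a in [pred a | base T a == v]])) => [|w].
  rewrite big_imset /=; last by move=> a b _ _; apply: foot_inj.
  rewrite (eq_bigr (fun a => if a is inr (i, _) then (i == k)%:R - (i == l)%:R else 0));
    last by move=> a /eqP <-; exact: dir_foot.
  rewrite big_mkcond big_sumType /= big1 ?add0r; last by move=> i _; rewrite if_same.
  have count (m : 'I_r.+1) : \sum_(p : 'I_r.+1 * 'I_d)
      (if base T (inr p) == v then (p.1 == m)%:R else 0) = (legs_at m v)%:R :> R.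
    transitivity (\sum_(i < r.+1) \sum_(j < d)
        (if base T (inr (i, j)) == v then (i == m)%:R else 0 : R)).
      by rewrite pair_bigA; apply: eq_bigr => -[].
    rewrite (bigD1 m) //= [X in _ + X]big1 ?addr0 => [|i /negbTE im]; last first.
      by apply: big1 => j _; rewrite im if_same.
    by rewrite /legs_at -sum1_card natr_sum [RHS]big_mkcond eqxx.
  rewrite -!count -!sumrB -sumrN; apply: eq_bigr => -[i j] _ /=.
  by rewrite inE; case: ifP => _; ring.
apply/andP/imsetP => [[vw /negPn/eqP/footP[a fw]]|[a /eqP <- ->]].
  exists a => //; rewrite inE; apply/eqP.
  have := leg_adj T a; rewrite fw adj_sym => wb.
  by apply: leaf_uniq_neighbour wb; [rewrite -fw foot_leaf|rewrite adj_sym].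
by rewrite leg_adj foot_leaf.
Qed.

(** The distance sums compensate the bending of [pos v k - pos v l] at the bases of the legs
    [(k, j)] and [(l, j)]. *)
Definition potential k l v : R :=
  pos v k - pos v l + (\sum_(j < d) vdist v (base T (inr (k, j)))
                     - \sum_(j < d) vdist v (base T (inr (l, j)))) / 2.

Lemma potential_harmonic k l v : inner v ->
  \sum_w conductance v w * (potential k l w - potential k l v) = 0.
Proof.
move=> iv.
(* Summing [vdist_laplacian] over [d] bases gives a term counting inner neighbours that is the same
   for every [m], so it cancels between [k] and [l]. *)
have lap m : \sum_w conductance v w *
     (\sum_(j < d) vdist w (base T (inr (m, j))) -
      \sum_(j < d) vdist v (base T (inr (m, j)))) =
  (#|[pred w | adj v w && inner w]|%:R - 2) *+ d + 2 * (legs_at m v)%:R.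
  under eq_bigr do rewrite -sumrB mulr_sumr.
  rewrite exchange_big /=.
  under eq_bigr do rewrite vdist_laplacian ?base_inner //.
  rewrite big_split /= sumr_const card_ord -mulr_sumr; congr (_ + _ * _).
  rewrite /legs_at -sum1_card natr_sum [RHS]big_mkcond.
  by apply: eq_bigr => j _; rewrite inE; case: eqP.
have dirs : \sum_w conductance v w *
     ((pos w k - pos w l) - (pos v k - pos v l)) =
   (legs_at l v)%:R - (legs_at k v)%:R.
  rewrite sum_conductance // -sum_inner_dir //; apply: eq_bigr => w /andP[vw iw].
  (* The edge length cancels against the conductance and leaves the difference of the two direction
     coordinates. *)
  have := classT_const (pos_affine vw iv iw) k l => /= ->.
  have := inner_len vw iv iw; move: (fine _) => x x0.
  by field; rewrite gt_eqF.
transitivity (((legs_at l v)%:R - (legs_at k v)%:R) +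
   (((#|[pred w | adj v w && inner w]|%:R - 2) *+ d + 2 * (legs_at k v)%:R) -
    ((#|[pred w | adj v w && inner w]|%:R - 2) *+ d + 2 * (legs_at l v)%:R)) / 2 : R);
  last by field.
rewrite -dirs -!lap -sumrB mulr_suml -big_split; apply: eq_bigr => w _.
by rewrite /potential /=; field.
Qed.

End TropicalCurve.

(** * Comparison of the evaluations at two marked points *)

Lemma ev_ratio (K : fieldType) (I : finType) (r d : nat) (C : lab_curve K I r d)
    (i i0 : I) (k : 'I_r.+1) :
  ev C i k * \prod_(j < d) cross (mark C (inl i0)) (mark C (inr (k, j))) =
  ev C i0 k * \prod_(j < d) cross (mark C (inl i)) (mark C (inr (k, j))).
Proof.
(* [form_ratio] needs two distinct points to span the line, so equal marks are split off. *)
have [->//|ii0] := eqVneq i i0.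
apply: form_ratio.
- exact: ev_neq0.
- by move=> j; apply: mark_distinct.
- by move=> j; apply: mark_distinct.
- by move=> j j' jj'; apply: mark_distinct; apply: contraNneq jj' => -[->].
- by move=> u u0; move/(forms_zeros C k u0).
- by apply: mark_distinct; apply: contraNneq ii0 => -[->].
Qed.

Theorem corollary3p6 (R : realType) (K : closedFieldType) (nu : K -> \bar R)
  (char0 : [pchar K] =i pred0) (hnu : is_valuation nu)
  (I : finType) (i0 : I) (r d : nat) (hr : (1 <= r)%N)
  (hL0 : (3 <= #|L0 I r d|)%N)
  (i : I) (C : lab_curve K I r d) (T : lab_trop_curve R I r d)
  (tropC : embedding i0 T = trop_embedding nu i0 C) :
  trop_ev T i = tropT nu (ev C i).
Proof.
case: tropC => eD eT.
apply: classT_tropT => // [k|k l]; first exact: ev_neq0.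
have posi0 : tropT nu (ev C i0) (pos (base T (inl i0))).
  by rewrite -eT; exact: mem_real_class.
have h0 := tropT_const hnu (ev_neq0 C i0) posi0 k l.
pose D i' (m : 'I_r.+1) : R := \sum_(j < d) vdist (base T (inl i')) (base T (inr (m, j))).
pose N i' (m : 'I_r.+1) : R :=
  \sum_(j < d) fine (nu (cross (mark C (inl i')) (mark C (inr (m, j))))).
have val_ev m : fine (nu (ev C i m)) + N i0 m = fine (nu (ev C i0 m)) + N i m.
  have c0 i' j : cross (mark C (inl i')) (mark C (inr (m, j))) != 0.
    exact: mark_distinct.
  have p0 i' : \prod_(j < d) cross (mark C (inl i')) (mark C (inr (m, j))) != 0.
    exact/prodf_neq0.
  have := congr1 (fun x => fine (nu x)) (ev_ratio C i i0 m).
  by rewrite !(fine_valM hnu) ?ev_neq0 // !(fine_val_prod hnu).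
(* For each [j] this is the cross-ratio of the marks [i], [i0], [(k, j)], [(l, j)], whose valuation
   the first component of the embedding fixes. *)
have DN : - D i k / 2 - D i0 l / 2 + D i l / 2 + D i0 k / 2 =
    N i k + N i0 l - N i l - N i0 k.
  rewrite -!sumrN !mulr_suml -!sumrN -!big_split /=; apply: eq_bigr => j _.
  have cr0 (q : Dpairs (L0 I r d)) : cross_coords C q != 0.
    exact: mark_distinct (valP q).
  have tD : tropD nu (cross_coords C)
      (fun q => - leg_dist T (val q).1 (val q).2 / 2).
    by rewrite -eD; apply: mem_real_class => q; rewrite /Phi addr0.
  have neq (i' : I) (m : 'I_r.+1) : inl i' != inr (m, j) :> L0 I r d by [].
  have := tropD_quad (neq i k) (neq i l) (neq i0 k) (neq i0 l) hnu cr0 tD.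
  by rewrite /leg_dist /cross_coords /=; lra.
have : potential k l (base T (inl i)) = potential k l (base T (inl i0)).
  apply: harmonic_const; [exact: potential_harmonic|exact: base_inner..].
have := val_ev k; have := val_ev l.
(* Constancy of the potential expresses the change of [pos] through [D], [DN] turns that into [N],
   [val_ev] turns [N] into the change of [ev], and [h0] settles the base point. *)
by rewrite /potential -/(D i k) -/(D i l) -/(D i0 k) -/(D i0 l); lra.
Qed.
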